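(* If the flow $(X,T)$ is strongly rigid, then the induced flow $(2^X,T)$ is weakly rigid.
   Context: A flow $(X,T)$ is an action $(t,x)\mapsto tx$ of an infinite discrete (not necessarily abelian) group $T$ by homeomorphisms on a compact, infinite metric space $(X,d)$; each $t\in T$ is identified with the map $x\mapsto tx$, and $e\in T$ is the identity. The enveloping semigroup $E(X)$ is the closure of $T$ in $X^X$ with the product (point-open) topology; it is a semigroup under composition. A nonempty $I\subset E(X)$ is a left ideal if $E(X)\cdot I\subset I$; a minimal ideal is a closed left ideal containing no left ideal as a proper subset. A minimal idempotent is an idempotent belonging to a minimal ideal. The flow is strongly rigid if every minimal idempotent $u\in E(X)$ is an accumulation point in $E(X)$ endowed with the compact-open topology, i.e. there is a (non-trivial) net $\{t_k\}$ in $T$ with $t_k\to u$ uniformly on $X$; non-trivial means $t_k\neq u$ for all $k$, and in particular, when $u=e$, no $t_k$ is the identity element of $T$. A flow $(X,T)$ is weakly rigid if for any $x_1,\dots,x_n\in X$ and $\epsilon>0$ there is $t\in T$, $t\neq e$, with $d(x_i,tx_i)<\epsilon$ for $i=1,\dots,n$. $2^X$ is the compact metric space of nonempty closed subsets of $X$ with the Hausdorff metric $d_H$; the induced flow $(2^X,T)$ is given by $tA=\{ta:a\in A\}$. *)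

(* Defs.v *)
From HB Require Import structures.
From mathcomp Require Import all_boot all_order all_algebra.
From mathcomp Require Import all_classical all_reals all_analysis.

Set Implicit Arguments.
Unset Strict Implicit.
Unset Printing Implicit Defensive.

Import Order.TTheory GRing.Theory Num.Theory.
Import numFieldNormedType.Exports.

Local Open Scope classical_set_scope.
Local Open Scope ring_scope.

HB.mixin Record isCompactSpace X of Topological X := {
  compact_space : compact [set: X]
}.

#[short(type="compactMetricType")]
HB.structure Definition CompactMetric (R : numDomainType) :=
  {X of Metric R X & isCompactSpace X}.

(* Each [phi t] is a homeomorphism, with inverse [phi t^-1].  The group is
   discrete, so no joint continuity is required.  The action need not be
   effective: distinct elements of T may induce the same map. *)
Record flow (R : realType) (T : groupType) (X : compactMetricType R) := Flow {
  flow_act :> T -> X -> X;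
  flow_group_infinite : infinite_set [set: T];
  flow_space_infinite : infinite_set [set: X];
  flow_act1 : forall x, flow_act 1%g x = x;
  flow_actM : forall s t x, flow_act (s * t)%g x = flow_act s (flow_act t x);
  flow_act_continuous : forall t, continuous (flow_act t)
}.
Arguments flow_act_continuous {R T X} f t [x] [_].

Section EnvelopingSemigroup.
Context {R : realType} {T : groupType} {X : compactMetricType R}.
Variable phi : flow T X.

Definition enveloping_semigroup : set {ptws X -> X} :=
  closure (range (phi : T -> {ptws X -> X})).

Definition left_ideal (I : set {ptws X -> X}) : Prop :=
  [/\ I !=set0, I `<=` enveloping_semigroup &
      forall p q : X -> X, enveloping_semigroup p -> I q -> I (p \o q)].

Definition minimal_ideal (I : set {ptws X -> X}) : Prop :=
  [/\ left_ideal I, closed I &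
      forall J, left_ideal J -> ~ J `<` I].

Definition minimal_idempotent (u : X -> X) : Prop :=
  u \o u = u /\ exists2 I, minimal_ideal I & I u.

End EnvelopingSemigroup.

Definition directed_preorder (K : Type) (le : K -> K -> Prop) : Prop :=
  [/\ [set: K] !=set0, (forall k, le k k),
      (forall j k l, le j k -> le k l -> le j l) &
      forall j k, exists2 l, le j l & le k l].

(* The filter of eventual sets: a net f : K -> Y converges to y exactly when
   [f @ eventually_in le --> y]. *)
Definition eventually_in (K : Type) (le : K -> K -> Prop) : set_system K :=
  filter_from [set: K] (fun k0 => [set k | le k0 k]).

(* Non-triviality of the net is required in E(X), i.e. between maps; when u is
   the identity map it implies that no [t k] is the identity element of T. *)
Definition strongly_rigid (R : realType) (T : groupType)
    (X : compactMetricType R) (phi : flow T X) : Prop :=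
  forall u : X -> X, minimal_idempotent phi u ->
    exists (K : Type) (le : K -> K -> Prop) (t : K -> T),
      [/\ directed_preorder le, (forall k, phi (t k) <> u) &
          {uniform, (fun k => phi (t k)) @ eventually_in le --> u}].

Definition weakly_rigid (R : realType) (T : groupType)
    (X : compactMetricType R) (phi : flow T X) : Prop :=
  forall (n : nat) (x : 'I_n -> X) (e : R), 0 < e ->
    exists2 t : T, t <> 1%g & forall i, mdist (x i) (phi t (x i)) < e.

Record hyperspace (X : topologicalType) := Hyperspace {
  hyper_set :> set X;
  hyper_closed : closed hyper_set;
  hyper_nonempty : hyper_set !=set0
}.
Arguments hyper_closed {X} h.

HB.instance Definition _ (X : topologicalType) := gen_eqMixin (hyperspace X).
HB.instance Definition _ (X : topologicalType) :=
  gen_choiceMixin (hyperspace X).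

Lemma hyper_inj (X : topologicalType) (A B : hyperspace X) :
  (A : set X) = B -> A = B.
Proof.
case: A B => [A cA nA] [B cB nB] /= AB; subst B.
by congr Hyperspace; exact: Prop_irrelevance.
Qed.

Section HausdorffMetric.
Context {R : realType} {X : compactMetricType R}.
Implicit Types (A B C : hyperspace X) (e r : R).

Definition enlargement (A : set X) e : set X :=
  [set x | exists2 a, A a & mdist a x < e].

Definition hausdorff_radii (A B : set X) : set R :=
  [set e | [/\ 0 < e, A `<=` enlargement B e & B `<=` enlargement A e]].

Definition hausdorff_dist (A B : hyperspace X) : R :=
  inf (hausdorff_radii A B).

Lemma hausdorff_radiiC (A B : set X) :
  hausdorff_radii A B = hausdorff_radii B A.
Proof. by apply/seteqP; split=> e [e0 AB BA]. Qed.

Lemma hausdorff_radii_nonempty A B : hausdorff_radii A B !=set0.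
Proof.
have [a Aa] := hyper_nonempty A; have [b Bb] := hyper_nonempty B.
have /compact_near_coveringP cX := @compact_space R X.
have [M [_ Mx]] : \forall M \near +oo%R, [set: X] `<=` [set x | mdist a x < M].
  apply: (cX R (pinfty_nbhs R) (fun M x => mdist a x < M)) => x _.
  exists ([set y | mdist x y < 1], [set M | mdist a x + 1 < M]) => /=.
    split; last by exists (mdist a x + 1); rewrite num_real.
    have := @nbhsx_ballx R X x 1 ltr01.
    by rewrite ballEmdist.
  move=> [y M] /= [xy xM]; apply: le_lt_trans xM.
  by rewrite (le_trans (metric_triangle _ x _))// lerD2l ltW.
have {}Mx (x : X) : mdist a x < M + 1.
  by apply: (Mx (M + 1)) => //; rewrite ltrDl.
have M0 : 0 < M + 1 by rewrite (le_lt_trans _ (Mx a))// mdist_ge0.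
have xyM (x y : X) : mdist x y < (M + 1) + (M + 1).
  by rewrite (le_lt_trans (metric_triangle _ a _))// ltrD// metric_sym.
by exists ((M + 1) + (M + 1)); split; [exact: addr_gt0|move=> x _; exists b|
  move=> x _; exists a].
Qed.

Lemma hausdorff_radii_lb A B : lbound (hausdorff_radii A B) 0.
Proof. by move=> e [/ltW]. Qed.

Lemma hausdorff_dist_le A B e : hausdorff_radii A B e -> hausdorff_dist A B <= e.
Proof.
by move=> ABe; apply: (ge_inf _ ABe); exists 0; exact: hausdorff_radii_lb.
Qed.

Lemma hausdorff_dist_lt A B e : hausdorff_dist A B < e -> hausdorff_radii A B e.
Proof.
move=> /(inf_lt (hausdorff_radii_nonempty A B))[r [r0 AB BA] re]; split; first exact: lt_trans re.
- by move=> x /AB[y By yx]; exists y => //; exact: lt_trans re.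
- by move=> x /BA[y Ay yx]; exists y => //; exact: lt_trans re.
Qed.

Lemma hausdorff_dist_ge0 A B : 0 <= hausdorff_dist A B.
Proof.
by apply: lb_le_inf; [exact: hausdorff_radii_nonempty|
  exact: hausdorff_radii_lb].
Qed.

Lemma hausdorff_distxx A : hausdorff_dist A A = 0.
Proof.
apply/eqP; rewrite eq_le hausdorff_dist_ge0 andbT.
apply/ler_addgt0Pr => e e0; rewrite add0r; apply: hausdorff_dist_le.
by split=> // x Ax; exists x => //; rewrite mdistxx.
Qed.

Lemma hausdorff_dist_sym A B : hausdorff_dist A B = hausdorff_dist B A.
Proof. by rewrite /hausdorff_dist hausdorff_radiiC. Qed.

Lemma closed_enlargement (A : set X) x :
  closed A -> (forall e, 0 < e -> enlargement A e x) -> A x.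
Proof.
move=> cA Ax; apply: cA => V /nbhs_ballP[e /= e0 eV].
have [a Aa ax] := Ax e e0; exists a; split=> //.
by apply: eV; rewrite ballEmdist/= metric_sym.
Qed.

Lemma hausdorff_dist_eq0 A B : hausdorff_dist A B = 0 -> A = B.
Proof.
move=> AB0; have AB e : 0 < e -> hausdorff_radii A B e.
  by move=> e0; apply: hausdorff_dist_lt; rewrite AB0.
apply: hyper_inj; apply/seteqP; split=> x.
- move=> Ax; apply: closed_enlargement; first exact: hyper_closed.
  by move=> e /AB[_ + _]; exact.
- move=> Bx; apply: closed_enlargement; first exact: hyper_closed.
  by move=> e /AB[_ _]; exact.
Qed.

Lemma hausdorff_radiiD (A B C : set X) r e :
  hausdorff_radii A B r -> hausdorff_radii B C e ->
  hausdorff_radii A C (r + e).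
Proof.
move=> [r0 AB BA] [e0 BC CB]; split; first exact: addr_gt0.
- move=> x /AB[y /BC[z Cz zy] yx]; exists z => //.
  by rewrite (le_lt_trans (metric_triangle _ y _))// addrC ltrD.
- move=> x /CB[y /BA[z Az zy] yx]; exists z => //.
  by rewrite (le_lt_trans (metric_triangle _ y _))// ltrD.
Qed.

Lemma hausdorff_dist_triangle B A C :
  hausdorff_dist A C <= hausdorff_dist A B + hausdorff_dist B C.
Proof.
apply/ler_addgt0Pr => e e0; rewrite [e]splitr addrACA.
apply: hausdorff_dist_le; apply: (@hausdorff_radiiD A B C);
  by apply: hausdorff_dist_lt; rewrite ltrDl divr_gt0.
Qed.

HB.instance Definition _ := @isMetric.Build R (hyperspace X) hausdorff_dist
  hausdorff_distxx hausdorff_dist_eq0 hausdorff_dist_sym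
  hausdorff_dist_triangle.

Lemma hausdorff_mdistE A B : mdist A B = hausdorff_dist A B.
Proof. by []. Qed.

Lemma near_hausdorff_lt A e : 0 < e ->
  \forall B \near A, hausdorff_radii A (B : hyperspace X) e.
Proof.
move=> e0; have := @nbhsx_ballx R (hyperspace X) A e e0.
rewrite ballEmdist; apply: filterS => B; exact: hausdorff_dist_lt.
Qed.

Lemma near_mdist (x : X) e : 0 < e -> \forall y \near x, mdist x y < e.
Proof. by move=> e0; have := @nbhsx_ballx R X x e e0; rewrite ballEmdist. Qed.

Lemma hyperspace_compact : compact [set: hyperspace X].
Proof.
rewrite compact_ultra => F UF _.
pose meets (x : X) (e : R) : set (hyperspace X) :=
  [set B | exists2 b, (B : set X) b & mdist x b < e].
pose L := [set x : X | forall e, 0 < e -> F (meets x e)].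
have cL : closed L.
  move=> x clx e e0'; have e20 : 0 < e / 2 by rewrite divr_gt0.
  have [y [Ly xy]] := clx _ (near_mdist x e20).
  apply: filterS (Ly _ e20) => B [b Bb yb]; exists b => //.
  by rewrite (le_lt_trans (metric_triangle _ y _))// [e]splitr ltrD.
(* a closed set disjoint from L is missed by F-almost every set *)
have missL (K : set X) : closed K -> K `&` L = set0 ->
    F [set B : hyperspace X | K `<=` ~` (B : set X)].
  move=> cK KL0.
  have /compact_near_coveringP kK : compact K.
    exact: (subclosed_compact cK (@compact_space R X) (@subsetT _ _)).
  apply: (kK _ F (fun (B : hyperspace X) x => (~` (B : set X)) x)) => x Kx.
  have /existsNP[e /not_implyP[e0' nF]] : ~ L x.
    by move=> Lx; have : (K `&` L) x by []; rewrite KL0.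
  have [//|FC] := in_ultra_setVsetC (meets x e) UF.
  exists ([set y | mdist x y < e], ~` meets x e) => /=.
    by split=> //; exact: near_mdist.
  by move=> [y B] /= [xy nB] By; apply: nB; exists y.
have nL : L !=set0.
  apply/set0P/eqP => L0.
  have /filter_ex[B BX] : F [set B : hyperspace X | [set: X] `<=` ~` (B : set X)].
    by apply: missL; [exact: closedT|rewrite L0 setI0].
  by have [b Bb] := hyper_nonempty B; exact: (BX b).
pose A := Hyperspace cL nL; exists A; split => //.
move=> V /nbhs_ballP[e /= e0' eV]; apply: filterS eV _.
have e20 : 0 < e / 2 by rewrite divr_gt0.
have e40 : 0 < e / 2 / 2 by rewrite divr_gt0.
have F1 : F [set B : hyperspace X | L `<=` enlargement B (e / 2)].
  have /compact_near_coveringP kL : compact L.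
    exact: (subclosed_compact cL (@compact_space R X) (@subsetT _ _)).
  apply: (kL _ F (fun (B : hyperspace X) x => enlargement B (e / 2) x)) => x Lx.
  exists ([set y | mdist x y < e / 2 / 2], meets x (e / 2 / 2)) => /=.
    by split; [exact: near_mdist|exact: Lx].
  move=> [y B] /= [xy [b Bb xb]]; exists b => //.
  rewrite (le_lt_trans (metric_triangle _ x _))// (splitr (e / 2)) ltrD//.
  by rewrite metric_sym.
have F2 : F [set B : hyperspace X |
    [set x | forall a, L a -> e / 2 <= mdist a x] `<=` ~` (B : set X)].
  apply: missL; last first.
    by apply/seteqP; split=> // x [/= Lx Lx']; have := Lx _ Lx';
      rewrite mdistxx leNgt e20.
  move=> x clx a La; rewrite leNgt; apply/negP => ax.
  have [|y [/(_ _ La) ay /= xy]] := clx [set y | mdist x y < e / 2 - mdist a x].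
    by apply: near_mdist; rewrite subr_gt0.
  have := metric_triangle a x y; rewrite leNgt => /negP; apply.
  by rewrite (lt_le_trans _ ay)// -ltrBrDl.
apply: filterS2 F1 F2 => B LB BL; rewrite ballEmdist/= hausdorff_mdistE.
apply: (@le_lt_trans _ _ (e / 2)); last by rewrite [ltRHS]splitr ltrDl.
apply: hausdorff_dist_le; split=> // x Bx.
apply: contrapT => nx; apply: (BL x) => //= a La.
by rewrite leNgt; apply/negP => ax; apply: nx; exists a.
Qed.

HB.instance Definition _ :=
  isCompactSpace.Build (hyperspace X) hyperspace_compact.

End HausdorffMetric.

Section InducedFlow.
Context {R : realType} {T : groupType} {X : compactMetricType R}.
Variable phi : flow T X.

Lemma flow_image_closed t (A : hyperspace X) :
  closed (phi t @` (A : set X)).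
Proof.
apply: compact_closed; first exact: metric_hausdorff.
apply: continuous_compact.
  by apply: continuous_subspaceT; exact: flow_act_continuous.
exact: (subclosed_compact (hyper_closed A) (@compact_space R X) (@subsetT _ _)).
Qed.

Lemma flow_image_nonempty t (A : hyperspace X) :
  phi t @` (A : set X) !=set0.
Proof. by have [a Aa] := hyper_nonempty A; exists (phi t a), a. Qed.

Definition induced_act (t : T) (A : hyperspace X) : hyperspace X :=
  Hyperspace (@flow_image_closed t A) (flow_image_nonempty t A).

Lemma induced_act1 A : induced_act 1%g A = A.
Proof.
apply: hyper_inj => /=; rewrite -[RHS]image_id.
by congr image; apply/funext => x /=; rewrite flow_act1.
Qed.

Lemma induced_actM s t A :
  induced_act (s * t)%g A = induced_act s (induced_act t A).
Proof.
apply: hyper_inj => /=; rewrite image_comp.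
by congr image; apply/funext => x /=; rewrite flow_actM.
Qed.

Lemma flow_unif_continuous t (e : R) : 0 < e ->
  exists2 d : R, 0 < d &
    forall x y, mdist x y < d -> mdist (phi t x) (phi t y) < e.
Proof.
move=> e0; have e20 : 0 < e / 2 by rewrite divr_gt0.
have /compact_near_coveringP cX := @compact_space R X.
have [d /= d0 dX] : \forall d \near 0^'+, [set: X] `<=`
    [set x | forall y, mdist x y < d -> mdist (phi t x) (phi t y) < e].
  apply: (cX R (0^'+)
    (fun d x => forall y, mdist x y < d -> mdist (phi t x) (phi t y) < e)).
  move=> x _.
  have /nbhs_ballP[r /= r0 rx] :=
    flow_act_continuous phi t (near_mdist (phi t x) e20).
  have r20 : 0 < r / 2 by rewrite divr_gt0.
  exists ([set y | mdist x y < r / 2], [set d | d < r / 2]) => /=.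
    by split; [exact: near_mdist|exact: nbhs_right_lt].
  move=> [y d] /= [xy dr] z yz.
  have ty : mdist (phi t x) (phi t y) < e / 2.
    apply: rx; rewrite ballEmdist/= (lt_trans xy)//.
    by rewrite [ltRHS]splitr ltrDl.
  have tz : mdist (phi t x) (phi t z) < e / 2.
    apply: rx; rewrite ballEmdist/= (le_lt_trans (metric_triangle _ y _))//.
    by rewrite [ltRHS]splitr ltrD// (lt_trans yz).
  rewrite (le_lt_trans (metric_triangle _ (phi t x) _))// [ltRHS]splitr ltrD//.
  by rewrite metric_sym.
have d20 : 0 < d / 2 by rewrite divr_gt0.
exists (d / 2) => // x y xy; apply: (dX (d / 2)) xy => //=.
by rewrite sub0r normrN gtr0_norm// [ltRHS]splitr ltrDl.
Qed.

Lemma induced_act_continuous t : continuous (induced_act t).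
Proof.
move=> A V /nbhs_ballP[e /= e0 eV].
have e20 : 0 < e / 2 by rewrite divr_gt0.
have [d d0 dt] := flow_unif_continuous t e20.
apply: filterS (near_hausdorff_lt A d0) => B [_ AB BA].
apply: eV; rewrite ballEmdist/= hausdorff_mdistE.
apply: (@le_lt_trans _ _ (e / 2)); last by rewrite [ltRHS]splitr ltrDl.
apply: hausdorff_dist_le; split=> //.
- move=> _ [a /AB[b Bb ba] <-]; exists (phi t b); last exact: dt.
  by exists b.
- move=> _ [b /BA[a Aa ab] <-]; exists (phi t a); last exact: dt.
  by exists a.
Qed.

Lemma hyperspace_infinite : infinite_set [set: hyperspace X].
Proof.
have cl1 (x : X) : closed [set x].
  by apply: accessible_closed_set1; apply: hausdorff_accessible;
     exact: metric_hausdorff.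
have n1 (x : X) : [set x] !=set0 by exists x.
pose f x := Hyperspace (cl1 x) (n1 x).
have finj : injective f.
  move=> x y /(congr1 (@hyper_set X)) /= xy.
  by have : [set y] x by rewrite -xy.
move=> fin; apply: (flow_space_infinite phi).
apply: (@sub_finite_set _ _ (f @^-1` setT)) => //.
by apply: finite_preimage fin => x y _ _; exact: finj.
Qed.

Definition induced_flow : flow T (hyperspace X) :=
  Flow (flow_group_infinite phi) hyperspace_infinite
    induced_act1 induced_actM induced_act_continuous.

End InducedFlow.

(* Main.v *)
Require Import Defs.
From mathcomp Require Import all_boot all_order all_algebra.
From mathcomp Require Import all_classical all_reals all_analysis.

(** The theorem rests on the observation that strong rigidity leaves no room
    for a nontrivial minimal idempotent.  Let [u] be a minimal idempotent and
    [t_k] a net in the group converging to [u] uniformly.  Then [u] is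
    continuous, and given [y] the points [x_k := t_k^-1 y] satisfy
    [d (u x_k, y) = d (u x_k, t_k x_k) -> 0]; applying the continuous map [u],
    which fixes every [u x_k], gives [u y = y].  So [u] is the identity.  The
    maps [t_k] differ from [u], so no [t_k] is [1]; far along the net, [t_k]
    moves every point of [X] by less than a prescribed amount, and therefore
    moves every closed subset by as little in the Hausdorff metric.

    What remains is that a minimal idempotent exists.  The pointwise topology
    makes the maps [X -> X] a compact Hausdorff semigroup in which every right
    multiplication [p |-> p \o q] is continuous.  Compactness and Zorn's lemma
    ([compact_exists_minimal]) are used twice: for a minimal closed left ideal
    [I] of the enveloping semigroup, and, in the Ellis-Numakura lemma, for a
    minimal closed subsemigroup of [I], all of whose elements turn out to be
    idempotent. *)

Set Implicit Arguments.
Unset Strict Implicit.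
Unset Printing Implicit Defensive.

Import Order.TTheory GRing.Theory Num.Theory.
Import numFieldNormedType.Exports.

Local Open Scope classical_set_scope.
Local Open Scope ring_scope.

(** * Idempotents in compact right topological semigroups *)

(** Zorn's lemma applies downwards because, by compactness, the intersection
    of a chain of nonempty closed sets is nonempty. *)
Lemma compact_exists_minimal (Y : topologicalType) (P : set (set Y))
    (K : set Y) :
  (forall F : set (set Y), F !=set0 -> F `<=` P -> P (\bigcap_(A in F) A)) ->
  compact K -> closed K -> K !=set0 -> P K ->
  exists M, [/\ M `<=` K, closed M, M !=set0, P M &
    forall N, N `<=` M -> closed N -> N !=set0 -> P N -> N = M].
Proof.
move=> capP cK clK K0 PK.
pose good (A : set Y) := [/\ A `<=` K, closed A, A !=set0 & P A].
(* Zorn_bigcup looks for maximal sets, so sets are replaced by their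
   complements in K; the empty chain then corresponds to K itself. *)
have [F FP Ftot|B [[BK gB] maxB]] :=
    @Zorn_bigcup Y [set B | B `<=` K /\ good (K `\` B)].
  have [->|F0] := eqVneq F set0.
    by rewrite bigcup_set0 /= setD0; split; [exact: sub0set|split].
  split; first by apply: bigcup_sub => B /FP[].
  pose G := [set K `\` B | B in F].
  have G0 : G !=set0 by case/set0P: F0 => B FB; exists (K `\` B), B.
  have -> : K `\` \bigcup_(B in F) B = \bigcap_(A in G) A.
    apply/seteqP; split => [x [Kx nx] _ [B FB <-]|x xG].
      by split => // Bx; apply: nx; exists B.
    have [_ [B0 FB0 _]] := G0.
    split; first by have [] := xG (K `\` B0) (imageP _ FB0).
    by move=> [B FB Bx]; have [_] := xG (K `\` B) (imageP _ FB).
  have Ggood A : G A -> good A by move=> [B /FP[_ gB] <-].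
  have Gfilter : ProperFilter (filter_from G id).
    apply: filter_from_proper; last by move=> A /Ggood[].
    apply: filter_from_filter => // _ _ [A FA <-] [B FB <-].
    have [AB|BA] := Ftot A B FA FB.
      by exists (K `\` B); [exists B|move=> x [Kx nBx]; split; split=> // /AB].
    by exists (K `\` A); [exists A|move=> x [Kx nAx]; split; split=> // /BA].
  have [A0 GA0] := G0.
  have FK : filter_from G id K by exists A0 => //; case: (Ggood _ GA0).
  have [y [Ky cy]] := cK _ Gfilter FK.
  split.
  - by move=> x /(_ _ GA0); case: (Ggood _ GA0) => + _ _ _; apply.
  - by apply: closed_bigI => A /Ggood[].
  - exists y => A GA; have [_ clA _ _] := Ggood A GA.
    by apply: clA => V yV; apply: cy => //; exists A.
  - by apply: capP => // A /Ggood[].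
exists (K `\` B); case: (gB) => MK cM M0 PM; split=> // N NM cN N0 PN.
have NK : N `<=` K by exact: subset_trans NM MK.
apply: contrapT => NMne; apply: (maxB (K `\` N)).
  split; first by move=> x Bx; split; [exact: BK|move=> /NM[]].
  move=> KNB; apply: NMne; apply/seteqP; split=> // x [Kx nBx].
  by apply: contrapT => nNx; apply/nBx/KNB.
by split; [exact: subDsetl|rewrite setDD setIidr].
Qed.

(** The Ellis-Numakura lemma.  If [u] lies in a minimal closed subsemigroup
    [M], then [M u] is a closed subsemigroup of [M], hence equals [M] and
    contains [u]; so the closed subsemigroup of the [p] in [M] with [p u = u]
    is nonempty, hence equals [M] as well and contains [u]. *)
Lemma compact_semigroup_idempotent (S : topologicalType) (op : S -> S -> S)
    (K : set S) :
  hausdorff_space S -> associative op -> (forall q, continuous (op^~ q)) ->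
  compact K -> K !=set0 -> (forall p q, K p -> K q -> K (op p q)) ->
  exists2 u, K u & op u u = u.
Proof.
move=> hS opA opC cK K0 KM.
have clK := compact_closed hS cK.
pose sub (A : set S) := forall p q, A p -> A q -> A (op p q).
have [F F0 Fsub p q pF qF A FA|//|//|//|//|M [MK cM M0 Msub minM]] :=
    @compact_exists_minimal S sub K.
  by apply: Fsub => //; [exact: pF|exact: qF].
have [u Mu] := M0; exists u; first exact: MK.
have MuE : op^~ u @` M = M.
  apply: minM.
  - by move=> _ [p Mp <-]; exact: Msub.
  - apply: compact_closed => //; apply: continuous_compact.
      by apply: continuous_subspaceT; exact: opC.
    exact: subclosed_compact cM cK MK.
  - by exists (op u u), u.
  - move=> _ _ [p Mp <-] [q Mq <-]; exists (op (op p u) q); last by rewrite opA.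
    by apply: (Msub) => //; exact: Msub.
have [e Me eu] : (op^~ u @` M) u by rewrite MuE.
suff ME : M `&` [set p | op p u = u] = M.
  by have [] : (M `&` [set p | op p u = u]) u by rewrite ME.
apply: minM.
- exact: subIsetl.
- apply: closedI => //.
  apply: ((continuous_closedP _).1 (opC u) [set u]).
  by apply: accessible_closed_set1; exact: hausdorff_accessible.
- by exists e.
- move=> p q [Mp pu] [Mq qu]; split; first exact: Msub.
  by rewrite /= -opA qu.
Qed.

(** * Pointwise and uniform convergence *)

Section PointwiseTopology.
Variables (X : choiceType) (Y : topologicalType).

Lemma ptws_compact : compact [set: Y] -> compact [set: {ptws X -> Y}].
Proof.
move=> cY; have := @tychonoff X (fun=> Y) (fun=> setT) (fun=> cY).
by congr (compact _); apply/seteqP.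
Qed.

Lemma ptws_hausdorff : hausdorff_space Y -> hausdorff_space {ptws X -> Y}.
Proof. by move=> hY; exact: (@hausdorff_product X (fun=> Y)). Qed.

Lemma ptws_eval_continuous (x : X) :
  continuous ((fun f => f x) : {ptws X -> Y} -> Y).
Proof. exact: (@proj_continuous X (fun=> Y) x). Qed.

Lemma ptws_continuous (Z : topologicalType) (f : Z -> {ptws X -> Y}) :
  (forall x, continuous (fun z => f z x)) -> continuous f.
Proof.
move=> fx z; apply/cvg_sup.
move=> x; move: z.
apply/(@continuousP _ (initial_topology (@proj X (fun=> Y) x))) => _ [B oB <-].
by apply: (@open_comp _ _ (fun z => f z x)) oB => z _; exact: fx.
Qed.

End PointwiseTopology.

Lemma eventually_in_proper (K : Type) (le : K -> K -> Prop) :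
  directed_preorder le -> ProperFilter (eventually_in le).
Proof.
move=> [[k0 _] lerefl letrans lejoin].
apply: filter_from_proper; last by move=> k _; exists k; exact: lerefl.
apply: filter_from_filter; first by exists k0.
move=> j k _ _; have [l jl kl] := lejoin j k; exists l => // m lm.
by split; [exact: letrans lm|exact: letrans lm].
Qed.

Lemma near_uniform_ball (R : realType) (U : choiceType)
    (V : pseudoMetricType R) (I : Type) (F : set_system I) (f : I -> U -> V)
    (g : U -> V) (e : R) :
  0 < e -> {uniform, f @ F --> g} ->
  \forall i \near F, forall x, ball (g x) e (f i x).
Proof.
move=> e0 Fg; apply: (Fg [set h | forall x, ball (g x) e (h x)]).
apply/uniform_nbhs; exists [set xy | ball xy.1 e xy.2]; split.
  exact: (entourage_ball _ (PosNum e0)).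
by move=> h gh x; exact: gh.
Qed.

Lemma continuous_closure_sub (Y Z : topologicalType) (f : Y -> Z)
    (A : set Y) (B : set Z) :
  continuous f -> closed B -> (forall y, A y -> B (f y)) ->
  forall y, closure A y -> B (f y).
Proof.
move=> cf cB AB; have /continuous_closedP/(_ _ cB) cfB := cf.
by rewrite closureE; exact: smallest_sub.
Qed.

(** * Minimal idempotents of a flow *)

Section Flow.
Context {R : realType} {T : groupType} {X : compactMetricType R}.
Variable phi : flow T X.

Local Notation E := (enveloping_semigroup phi).

Lemma precomp_continuous (q : X -> X) :
  continuous ((fun p => p \o q) : {ptws X -> X} -> {ptws X -> X}).
Proof. by apply: ptws_continuous => x; exact: ptws_eval_continuous. Qed.

Lemma postcomp_continuous (f : X -> X) : continuous f ->
  continuous ((fun p => f \o p) : {ptws X -> X} -> {ptws X -> X}).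
Proof.
move=> cf; apply: ptws_continuous => x p.
by apply: (@continuous_comp _ _ _ (fun g : {ptws X -> X} => g x) f);
  [exact: ptws_eval_continuous|exact: cf].
Qed.

(** Right multiplications are continuous, left ones need not be, so
    closure under composition is reduced one factor at a time: continuity of
    [p |-> p \o q] reduces [p] to a group element [s], and then continuity of
    [q |-> phi s \o q] reduces [q] to a group element. *)
Lemma enveloping_semigroup_comp (p q : X -> X) : E p -> E q -> E (p \o q).
Proof.
move=> + Eq; move: p.
apply: (continuous_closure_sub (precomp_continuous (q := q))).
  exact: closed_closure.
move=> _ [s _ <-]; move: q Eq.
have cs := postcomp_continuous (flow_act_continuous phi s).
apply: (continuous_closure_sub cs).
  exact: closed_closure.
move=> _ [t _ <-]; apply: subset_closure; exists (s * t)%g => //.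
by apply/funext => x; rewrite flow_actM.
Qed.

Let hX : hausdorff_space {ptws X -> X}.
Proof. by apply: ptws_hausdorff; exact: metric_hausdorff. Qed.

Let compact_sub (A : set {ptws X -> X}) : closed A -> compact A.
Proof.
move=> cA; apply: subclosed_compact cA _ (@subsetT _ _).
by apply: ptws_compact; exact: compact_space.
Qed.

(** A minimal closed left ideal [I] contains no smaller left ideal [J], closed
    or not: for [q] in [J] the set [E q] is a closed left ideal inside [J]. *)
Lemma exists_minimal_ideal : exists I, minimal_ideal phi I.
Proof.
pose P (A : set {ptws X -> X}) := forall p q : X -> X, E p -> A q -> A (p \o q).
have cE : closed E by exact: closed_closure.
have E1 : E (phi 1%g) by apply: subset_closure; exists 1%g.
have [F F0 FP p q Ep Fq A FA| | | | |I [IE cI I0 PI minI]] :=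
    @compact_exists_minimal {ptws X -> X} P E.
- by apply: FP => //; exact: Fq.
- exact: compact_sub.
- exact: cE.
- by exists (phi 1%g).
- exact: enveloping_semigroup_comp.
exists I; split=> // J [[q Jq] _ PJ] [JI nIJ].
pose Eq : set {ptws X -> X} := (fun p => p \o q) @` E.
have EqJ : Eq `<=` J by move=> _ [p Ep <-]; exact: PJ.
have EqI : Eq = I.
  apply: minI.
  - exact: subset_trans EqJ JI.
  - apply: compact_closed; first exact: hX.
    apply: continuous_compact; last exact: compact_sub.
    by apply: continuous_subspaceT; exact: precomp_continuous.
  - by exists (phi 1%g \o q), (phi 1%g).
  - move=> p _ Ep [r Er <-]; exists (p \o r) => //.
    exact: enveloping_semigroup_comp.
by apply: nIJ; rewrite -EqI.
Qed.

Lemma exists_minimal_idempotent : exists u, minimal_idempotent phi u.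
Proof.
have [I mI] := exists_minimal_ideal; have [[I0 IE PI] cI _] := mI.
have [u Iu uu] : exists2 u : X -> X, I u & u \o u = u.
  apply: (@compact_semigroup_idempotent {ptws X -> X}
    (fun p q => (p : X -> X) \o q)) => //.
  - exact: precomp_continuous.
  - exact: compact_sub.
  - by move=> p q Ip Iq; apply: PI => //; exact: IE.
by exists u; split => //; exists I.
Qed.

Lemma flow_actVK t : cancel (phi t^-1%g) (phi t).
Proof. by move=> x; rewrite -flow_actM mulgV flow_act1. Qed.

(** Evaluating the net at the preimages [t_k^-1 y] shows that [y] is a limit
    of points of the image of [u]; the continuous map [u] fixes these, hence
    fixes [y]. *)
Lemma idempotent_uniform_limit_id (K : Type) (F : set_system K) (t : K -> T)
    (u : X -> X) :
  ProperFilter F -> u \o u = u ->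
  {uniform, (fun k => phi (t k)) @ F --> u} -> u = id.
Proof.
move=> FF uu Fu.
have cu : continuous u.
  apply: (@uniform_limit_continuous _ _ ((fun k => phi (t k)) @ F)) => //.
  by apply: (@filterE _ F) => k; exact: flow_act_continuous.
apply/funext => y; apply: metric_hausdorff => A B Auy By.
have /nbhs_ballP[e /= e0 eAB] : nbhs y (u @^-1` A `&` B).
  by apply: filterI => //; exact: cu.
have [k tu] : exists k, forall x, ball (u x) e (phi (t k) x).
  exact: filter_ex (near_uniform_ball e0 Fu).
have [Az Bz] : (u @^-1` A `&` B) (u (phi (t k)^-1%g y)).
  apply: eAB; apply: ball_sym.
  by rewrite -[X in ball _ _ X](flow_actVK (t k) y); exact: tu.
exists (u (phi (t k)^-1%g y)); split=> //.
by rewrite -[X in A X](congr1 (@^~ _) uu).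
Qed.

End Flow.

(** * Weak rigidity of the induced flow *)

Theorem proposition2p23 (R : realType) (T : groupType)
    (X : compactMetricType R) (phi : flow T X) :
  strongly_rigid phi -> weakly_rigid (induced_flow phi).
Proof.
move=> rigid n A e e0.
have [u mu] := exists_minimal_idempotent phi.
have [K [le [t [dle tu tcvg]]]] := rigid u mu.
have Fle := eventually_in_proper dle.
have uid : u = id.
  by have [uu _] := mu; exact: (idempotent_uniform_limit_id Fle uu tcvg).
have e20 : 0 < e / 2 by rewrite divr_gt0.
have [k tk] : exists k, forall x, mdist x (phi (t k) x) < e / 2.
  have [k tk] := filter_ex (near_uniform_ball e20 tcvg).
  by exists k => x; have := tk x; rewrite ballEmdist uid.
exists (t k).
  by move=> tk1; apply: (tu k); rewrite tk1 uid; apply/funext/flow_act1.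
move=> i; rewrite hausdorff_mdistE.
apply: (@le_lt_trans _ _ (e / 2)); last by rewrite [ltRHS]splitr ltrDl.
apply: hausdorff_dist_le; split=> //.
- by move=> x Ax; exists (phi (t k) x); [exists x|rewrite metric_sym].
- by move=> _ [x Ax <-]; exists x.
Qed.
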